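(* Let $F$ be a local field of characteristic zero and let $n\ge 2$ be an integer. Then the Borel chromatic number of the regular graph $\Gamma_n(F)$ is infinite; that is, $\mathrm{GL}_n(F)$ cannot be partitioned into finitely many Borel subsets none of which contains two adjacent vertices of $\Gamma_n(F)$.
   Context: A local field is a topological field whose topology is non-discrete and locally compact; a local field of characteristic zero is isomorphic to $\mathbb{R}$, $\mathbb{C}$, or a finite extension of $\mathbb{Q}_p$ for a prime $p$. For a field $F$ and $n\ge 2$, the regular graph $\Gamma_n(F)$ has vertex set $\mathrm{GL}_n(F)$, and two distinct vertices $x,y\in \mathrm{GL}_n(F)$ are adjacent if and only if $\det(x+y)=0$. When $F$ is a topological field, $\mathrm{GL}_n(F)$ carries the subspace topology from $\mathrm{M}_n(F)\cong F^{n^2}$. For a graph $\mathcal{G}$ whose vertex set is a topological space, the Borel chromatic number of $\mathcal{G}$ is the least cardinal $c$ such that the vertex set can be partitioned into $c$ Borel subsets none of which contains two adjacent vertices. *)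

(* Defs.v *)
From HB Require Import structures.
From mathcomp Require Import all_boot all_order all_algebra.
From mathcomp Require Import all_classical all_reals all_analysis.

Set Implicit Arguments.
Unset Strict Implicit.
Unset Printing Implicit Defensive.

Import GRing.Theory.
Local Open Scope classical_set_scope.
Local Open Scope card_scope.
Local Open Scope ring_scope.

HB.mixin Record TopologicalZmodule_isTopologicalField F
    & GRing.Field F & TopologicalZmodule F := {
  fmul_continuous : continuous (fun x : F * F => x.1 * x.2) ;
  finv_continuous : forall x : F, x != 0 -> {for x, continuous (@GRing.inv F)}
}.

#[short(type="topologicalFieldType")]
HB.structure Definition TopologicalField :=
  {F of GRing.Field F & TopologicalZmodule F
      & TopologicalZmodule_isTopologicalField F}.

(* As usual, "locally compact" includes the Hausdorff axiom; without it, any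
   field with the indiscrete topology would qualify. *)
Definition local_field (F : topologicalFieldType) : Prop :=
  [/\ hausdorff_space F, ~ (forall A : set F, open A)
    & locally_compact [set: F]].

(* GL F n is used as a type through the coercion of sets to types, which
   carries the topology induced by that of 'M[F]_n. *)
Definition GL (F : topologicalFieldType) (n : nat) : set 'M[F]_n :=
  [set A | A \in unitmx].
Arguments GL F n : clear implicits.

Definition regular_graph (F : topologicalFieldType) (n : nat)
    (x y : GL F n) : Prop :=
  x <> y /\ \det (val x + val y) = 0.

Definition borel (V : topologicalType) : set (set V) := <<s @open V >>.

Section BorelColorings.
Variables (V : topologicalType) (adj : V -> V -> Prop).

Definition independent (A : set V) : Prop :=
  forall x y, A x -> A y -> ~ adj x y.

(* A colouring is represented by the set P of its colour classes. *)
Definition borel_coloring (P : set (set V)) : Prop :=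
  [/\ partition P id [set: V], P `<=` @borel V & P `<=` independent].

(* A cardinal is represented by any set C having that cardinality. *)
Definition borel_chromatic_number (T : Type) (C : set T) : Prop :=
  (exists2 P : set (set V), borel_coloring P & P #= C) /\
  (forall Q : set (set V), borel_coloring Q -> C #<= Q).

End BorelColorings.

(* Main.v *)
Require Import Defs.
From HB Require Import structures.
From mathcomp Require Import all_boot all_order all_algebra.
From mathcomp Require Import all_classical all_reals all_analysis.

Set Implicit Arguments.
Unset Strict Implicit.
Unset Printing Implicit Defensive.

Local Open Scope classical_set_scope.
Local Open Scope ring_scope.
Import GRing.Theory.

(** The idea is that the closure of [GL_n(F)] in [M_n(F)] contains an infinite
    family of matrices any two of which have a singular sum, which would make it
    an infinite clique if its members were vertices.  Let [e] be the first basis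
    column.  The rank one matrices [m_j = e *m (1, j, 0, .., 0)] satisfy
    [(m_j + m_k) v = 0] with [m_j v = - m_k v <> 0] for a suitable nonzero
    column [v = v_(j,k)], as soon as [j] and [k] are distinct, because
    the characteristic is zero.  The same relations hold for the left
    translates [g m_j].  These matrices are singular, so they carry no colour,
    and the point is to give them one.

    Suppose that finitely many Borel classes [A] colour [GL_n(F)].  Every Borel
    set has the Baire property, so each [A] agrees with an open subset [U_A]
    of [M_n(F)] up to a meagre set.  The space [M_n(F)] is locally compact and
    Hausdorff, hence a Baire space, which has two consequences.

    - No two elements of [U_A] have a singular sum
      ([independent_sum_regular]).  If [z = x + y] were singular with [x, y] in
      [U_A], the open set of the [w] in [U_A] with [z - w] in [U_A] would be
      nonempty, so it would contain some [w] with [w] and [z - w] both in [A],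
      and these two are adjacent.
    - The union of the [U_A] is dense, since [GL_n(F)] is open and dense, so the
      finitely many closures of the [U_A] cover [M_n(F)] and every [g m_j] lies
      in one of them.

    By the pigeonhole principle, for every [g] there are [j <> k] and [A] with
    both [g m_j] and [g m_k] in the closure of [U_A].  On the other hand, for
    given [A], [j] and [k], this happens only for [g] in a closed set with empty
    interior ([sum_regular_clique]): otherwise, moving [g] slightly and
    approaching [g m_j] and [g m_k] by elements [x] and [y] of [U_A], one
    arranges that [x v = - y v], so that [x + y] is singular.  By Baire's
    theorem some [g] avoids these countably many sets, a contradiction. *)

(** * Baire category in locally compact spaces *)

(** Meagre sets only occur through their complements: the residual sets form a
    filter, so that statements which hold up to a meagre set can be combined by
    the filter calculus. *)
Definition residual (T : topologicalType) : set_system T :=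
  [set A | exists2 G : nat -> set T, (forall k, open (G k) /\ dense (G k)) &
     \bigcap_k G k `<=` A].

Lemma residual_open_dense (T : topologicalType) (A : set T) :
  open A -> dense A -> residual A.
Proof. by move=> oA dA; exists (fun=> A) => // x /(_ 0%N I). Qed.

Lemma residual_bigcap (T : topologicalType) (A : nat -> set T) :
  (forall k, residual (A k)) -> residual (\bigcap_k A k).
Proof.
move=> resA.
have /choice[G GP] : forall k, exists G : nat -> set T,
    (forall l, open (G l) /\ dense (G l)) /\ \bigcap_l G l `<=` A k.
  by move=> k; have [G God GA] := resA k; exists G.
exists (fun m => if unpickle m is Some (k, l) then G k l else setT).
  move=> m; case: (unpickle m) => [[k l]|]; first exact: (GP k).1.
  by split; [exact: openT|move=> O O0 _; rewrite setIT].
move=> x Gx k _; apply: (GP k).2 => l _.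
by have := Gx (pickle (k, l)) I; rewrite pickleK.
Qed.

#[global] Instance residual_filter (T : topologicalType) : Filter (@residual T).
Proof.
split.
- exists (fun=> setT) => // k.
  by split; [exact: openT|move=> O O0 _; rewrite setIT].
- move=> A B resA resB.
  have /residual_bigcap : forall k : nat, residual (if k is 0 then A else B).
    by case.
  move=> [G God GAB]; exists G => // x /GAB ABx; split.
    exact: (ABx 0%N I).
  exact: (ABx 1%N I).
- by move=> A B AB [G God GA]; exists G => // x /GA /AB.
Qed.

Lemma residual_countable_bigcap (T : topologicalType) (I : Type) (D : set I)
    (A : I -> set T) :
  countable D -> (forall i, D i -> residual (A i)) ->
  residual (\bigcap_(i in D) A i).
Proof.
move=> cD resA.
have /countable_injP[f finj] := cD.
(* The index [i] is put in place [f i] of a sequence. *)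
have /residual_bigcap : forall k,
    residual (\bigcap_(i in [set i | D i /\ f i = k]) A i).
  move=> k; have [[i [Di fi]]|nk] := pselect (exists i, D i /\ f i = k).
    apply: filterS (resA i Di) => x Ax j [Dj fj].
    suff -> : j = i by [].
    by apply: finj; rewrite ?inE // fi fj.
  by apply: filterE => x i Di; case: nk; exists i.
by apply: filterS => x Ax i Di; exact: (Ax (f i)).
Qed.

Lemma residual_involution (T : topologicalType) (f : T -> T) (A : set T) :
  continuous f -> involutive f -> residual A -> residual (f @^-1` A).
Proof.
move=> cf ff [G God GA]; exists (fun k => f @^-1` G k) => [k|x Gx]; last first.
  by apply: GA => k; exact: Gx.
have [oG dG] := God k; split; first by move/continuousP: cf; apply.
move=> O [x Ox] oO.
have [|y [Oy Gy]] := dG (f @^-1` O) _ ((continuousP f).1 cf _ oO).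
  by exists (f x); rewrite /= ff.
by exists (f y); split=> //=; rewrite ff.
Qed.

Definition baire_property (T : topologicalType) (A : set T) : Prop :=
  exists2 U : set T, open U & \forall x \near @residual T, A x <-> U x.

Lemma dense_setU_exterior (T : topologicalType) (U : set T) :
  dense (U `|` ~` closure U).
Proof.
move=> O [x Ox] oO.
have [Ux|nUx] := pselect (closure U x); last by exists x; split=> //; right.
have [y [Uy Oy]] := Ux O (open_nbhs_nbhs (conj oO Ox)).
by exists y; split=> //; left.
Qed.

(** For the complement of a set that agrees generically with an open set [U],
    the open set to take is the exterior of [U]: the two together are open and
    dense, so the boundary of [U] can be neglected. *)
Lemma baire_property_sigma (T : topologicalType) :
  sigma_algebra setT (@baire_property T).
Proof.
split.
- by exists set0; [exact: open0|apply: filterE].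
- move=> A [U oU AU]; exists (~` closure U).
    by rewrite openC; exact: closed_closure.
  have := @residual_open_dense T _
    (openU oU (closed_openC (@closed_closure _ U))) (@dense_setU_exterior T U).
  apply: filterS2 AU => x AU [Ux|nUx].
    have nUx : ~ (~` closure U) x by apply; exact: subset_closure.
    by split=> //= -[_]; have := AU.2 Ux.
  split=> // _; split=> // /AU Ux; apply: nUx; exact: subset_closure.
- move=> A bpA.
  have /choice[U UP] : forall k, exists U, open U /\
      \forall x \near @residual T, A k x <-> U x.
    by move=> k; have [U oU AU] := bpA k; exists U.
  exists (\bigcup_k U k); first by apply: bigcup_open => k _; exact: (UP k).1.
  have := residual_bigcap (fun k => (UP k).2).
  apply: filterS => x AU; split=> -[k _ Akx]; exists k => //;
    exact/(AU k I).
Qed.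

Lemma baire_propertyI (T : topologicalType) (A B : set T) :
  baire_property A -> baire_property B -> baire_property (A `&` B).
Proof.
move=> [U oU AU] [V oV BV]; exists (U `&` V); first exact: openI.
by apply: filterS2 AU BV => x [AU UA] [BV VB]; split=> -[]; split; auto.
Qed.

Lemma open_baire_property (T : topologicalType) (U : set T) :
  open U -> baire_property U.
Proof. by move=> oU; exists U => //; apply: filterE. Qed.

(** The sets of the subspace [D] whose image in [T] has the Baire property form
    a sigma-algebra, because [D] itself is open in [T]; this transfers the Borel
    sets of a subspace, where the colour classes live, to the ambient space,
    where one can translate and take closures. *)
Lemma borel_image_baire_property (T : topologicalType) (D : set T)
    (A : set D) :
  open D -> borel A -> baire_property (val @` A).
Proof.
move=> oD; have [bp0 bpC bpU] := @baire_property_sigma T.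
apply: (@smallest_sub _ _ _ [set B : set D | baire_property (val @` B)]).
  split.
  - by rewrite /= image_set0.
  - move=> B bpB; rewrite /=.
    have -> : val @` (setT `\` B) = (setT `\` (val @` B)) `&` D.
      apply/seteqP; split=> [_ [x [_ nBx] <-]|x [[_ nBx] Dx]].
        split; last exact: set_valP.
        by split=> // -[y By /val_inj yx]; apply: nBx; rewrite -yx.
      exists (SigSub (mem_set Dx)) => //; split=> // Bx.
      by apply: nBx; exists (SigSub (mem_set Dx)).
    by apply: baire_propertyI; [exact: bpC|exact: open_baire_property].
  - by move=> B bpB /=; rewrite image_bigcup; exact: bpU.
move=> _ [W oW <-] /=; apply: open_baire_property.
have -> : (val : D -> T) @` (set_val @^-1` W) = W `&` D.
  apply/seteqP; split=> [_ [x Wx <-]|x [Wx Dx]].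
    by split=> //; exact: set_valP.
  by exists (SigSub (mem_set Dx)).
exact: openI.
Qed.

(** The proof chooses a decreasing sequence of nonempty open sets with compact
    closures, the [k]-th of which has its closure in the [k]-th dense open set;
    by compactness, the closures have a common point. *)
Theorem locally_compact_baire (T : topologicalType) (A : set T) :
  hausdorff_space T -> locally_compact [set: T] -> residual A -> dense A.
Proof.
move=> hT lcT [G God GA] O O0 oO.
have shrink (W V : set T) : open W -> W !=set0 -> open V -> dense V ->
    exists2 W', open W' /\ W' !=set0 &
      closure W' `<=` W `&` V /\ compact (closure W').
  move=> oW W0 oV dV.
  have [x WVx] := dV W W0 oW.
  have [//|K] := @lcT x; rewrite withinET => Kx [cptK clK].
  have WVKx : nbhs x ((W `&` V) `&` K).
    by apply: filterI Kx; apply: open_nbhs_nbhs; split=> //; exact: openI.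
  have [B Bx BWVK] := compact_regular hT cptK Kx WVKx.
  exists B°; first by split; [exact: open_interior|exists x].
  have cB : closure B° `<=` W `&` V `&` K.
    by apply: subset_trans BWVK; apply: closureS; exact: interior_subset.
  split; first by move=> y /cB[].
  apply: subclosed_compact cptK _; first exact: closed_closure.
  by move=> y /cB[].
pose P (W W' : set T) k := [/\ open W', W' !=set0,
  closure W' `<=` W `&` G k & compact (closure W')].
have /choice[f fP] : forall Wk : set T * nat, exists W',
    open Wk.1 -> Wk.1 !=set0 -> P Wk.1 W' Wk.2.
  move=> [W k] /=.
  have [[oW W0]|nW] := pselect (open W /\ W !=set0); last first.
    by exists set0 => oW W0; case: nW.
  have [W' [oW' W'0] [W'W W'c]] := shrink _ _ oW W0 (God k).1 (God k).2.
  by exists W'.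
pose fix W n := if n is k.+1 then f (W k, k) else O.
have oW k : open (W k) /\ W k !=set0.
  elim: k => [|k [oW W0]] //.
  by have [] := fP (W k, k) oW W0.
have WP k : P (W k) (W k.+1) k.
  by have [oWk Wk0] := oW k; exact: (fP (W k, k)).
have Wdecr k l : (k <= l)%N -> W l `<=` W k.
  elim: l => [|l IH]; first by rewrite leqn0 => /eqP ->.
  rewrite leq_eqVlt => /orP[/eqP->//|/IH]; apply: subset_trans.
  have [_ _ h _] := WP l; apply: subset_trans (subset_trans h _) => //.
    exact: subset_closure.
have FF : ProperFilter (filter_from setT W).
  apply: filter_from_proper; last by move=> k _; exact: (oW k).2.
  apply: filter_from_filter; first by exists 0%N.
  move=> i j _ _; exists (maxn i j) => // x Wx; split; apply: Wdecr Wx.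
    exact: leq_maxl.
  exact: leq_maxr.
have [_ _ W1O cptW1] := WP 0%N.
have [|x [_ clx]] := cptW1 _ FF.
  by exists 1%N => //; exact: subset_closure.
have Wx k : closure (W k.+1) x.
  by move=> B Bx; apply: (clx (W k.+1) B) => //; exists k.+1.
exists x; split; first by have [] := W1O _ (Wx 0%N).
by apply: GA => k _; have [_ _ /(_ x (Wx k))[]] := WP k.
Qed.

(** * Matrices over a topological field *)

Section MatrixTopology.
Variables (T : topologicalType) (m n : nat).

Lemma mx_coord_continuous (i : 'I_m) (j : 'I_n) :
  continuous (fun A : 'M[T]_(m, n) => A i j).
Proof.
move=> A B AB.
exists (fun i' j' => if (i' == i) && (j' == j) then B else setT).
  move=> i' j'; case: ifP => [/andP[/eqP-> /eqP->]//|_]; exact: filterT.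
by move=> N /(_ i j); rewrite !eqxx.
Qed.

Lemma continuous_entry (S : topologicalType) (f : S -> 'M[T]_(m, n)) i j :
  continuous f -> continuous (fun x => f x i j).
Proof.
move=> cf x; apply: (@continuous_comp _ _ _ f (fun A : 'M[T]_(m, n) => A i j)).
  exact: cf.
exact: mx_coord_continuous.
Qed.

Lemma mx_continuous (S : topologicalType) (f : S -> 'M[T]_(m, n)) :
  (forall i j, continuous (fun x => f x i j)) -> continuous f.
Proof.
move=> cf x A [P Px PA].
have : \forall y \near x, forall i j, P i j (f y i j).
  by apply: filter_forall => i; apply: filter_forall => j; exact: (cf i j x).
by apply: filterS => y; exact: PA.
Qed.

Lemma mx_hausdorff : hausdorff_space T -> hausdorff_space 'M[T]_(m, n).
Proof.
move=> hT A B clAB; apply/matrixP => i j; apply: hT => U V AU BV.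
have [N [NU NV]] := clAB _ _ (@mx_coord_continuous i j A U AU)
  (@mx_coord_continuous i j B V BV).
by exists (N i j).
Qed.

(** Tychonoff's theorem, carried over from functions on pairs of indices to
    matrices. *)
Lemma mx_compact (K : 'I_m -> 'I_n -> set T) : (forall i j, compact (K i j)) ->
  compact [set A : 'M[T]_(m, n) | forall i j, K i j (A i j)].
Proof.
move=> cK.
pose mx (f : prod_topology (fun _ : 'I_m * 'I_n => T)) : 'M[T]_(m, n) :=
  \matrix_(i, j) f (i, j).
have cmx : continuous mx.
  apply: mx_continuous => i j.
  have -> : (fun f => mx f i j) = proj (i, j) by apply/funext => f; rewrite mxE.
  exact: proj_continuous.
have := @tychonoff _ (fun _ : 'I_m * 'I_n => T) (fun ij => K ij.1 ij.2)
  (fun ij => cK ij.1 ij.2).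
move=> /(continuous_compact (continuous_subspaceT cmx)).
congr compact; apply/seteqP; split=> [_ [f Kf <-] i j|A KA].
  by rewrite mxE; exact: (Kf (i, j)).
by exists (fun ij => A ij.1 ij.2) => //; apply/matrixP => i j; rewrite mxE.
Qed.

Lemma mx_locally_compact : hausdorff_space T -> locally_compact [set: T] ->
  locally_compact [set: 'M[T]_(m, n)].
Proof.
move=> hT lcT A _; rewrite withinET.
have /choice[K KP] : forall ij : 'I_m * 'I_n, exists K,
    nbhs (A ij.1 ij.2) K /\ compact K.
  move=> [i j] /=; have [//|K] := @lcT (A i j); rewrite withinET.
  by move=> AK [cK _]; exists K.
exists [set B : 'M[T]_(m, n) | forall i j, K (i, j) (B i j)].
  exists (fun (i : 'I_m) (j : 'I_n) => K (i, j)) => // i j; exact: (KP (i, j)).1.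
have cK : compact [set B : 'M[T]_(m, n) | forall i j, K (i, j) (B i j)].
  by apply: (mx_compact (K := fun i j => K (i, j))) => i j; exact: (KP (i, j)).2.
by split => //; apply: (compact_closed (mx_hausdorff hT)).
Qed.

End MatrixTopology.

Section TopologicalField.
Variable F : topologicalFieldType.

Lemma continuous_fadd (S : topologicalType) (f g : S -> F) :
  continuous f -> continuous g -> continuous (fun x => f x + g x).
Proof.
move=> cf cg x.
apply: (@continuous_comp _ _ _ (fun x => (f x, g x))
  (fun z : F * F => z.1 + z.2)).
  by apply: cvg_pair; [exact: cf|exact: cg].
exact: add_continuous.
Qed.

Lemma continuous_fmul (S : topologicalType) (f g : S -> F) :
  continuous f -> continuous g -> continuous (fun x => f x * g x).
Proof.
move=> cf cg x.
apply: (@continuous_comp _ _ _ (fun x => (f x, g x))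
  (fun z : F * F => z.1 * z.2)).
  by apply: cvg_pair; [exact: cf|exact: cg].
exact: fmul_continuous.
Qed.

Lemma continuous_mxadd (S : topologicalType) m n (f g : S -> 'M[F]_(m, n)) :
  continuous f -> continuous g -> continuous (fun x => f x + g x).
Proof.
move=> cf cg; apply: mx_continuous => i j.
under eq_fun do rewrite mxE.
by apply: continuous_fadd; exact: continuous_entry.
Qed.

Lemma continuous_mulmx (S : topologicalType) m n p (f : S -> 'M[F]_(m, n))
    (g : S -> 'M[F]_(n, p)) :
  continuous f -> continuous g -> continuous (fun x => f x *m g x).
Proof.
move=> cf cg; apply: mx_continuous => i j.
under eq_fun do rewrite mxE.
apply: continuous_big => [|k _]; first exact: add_continuous.
by apply: continuous_fmul; exact: continuous_entry.
Qed.

Lemma continuous_mxopp m n : continuous (fun A : 'M[F]_(m, n) => - A).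
Proof.
apply: mx_continuous => i j.
under eq_fun do rewrite mxE.
move=> A; apply: continuous_comp; first exact: mx_coord_continuous.
exact: opp_continuous.
Qed.

Lemma continuous_det n : continuous (fun A : 'M[F]_n => \det A).
Proof.
apply: continuous_big => [|s _]; first exact: add_continuous.
refine (@continuous_fmul _ (fun=> _) _ _ _).
  exact: cst_continuous.
apply: continuous_big => [|i _]; first exact: fmul_continuous.
exact: mx_coord_continuous.
Qed.

Lemma continuous_mxaffine m n p (c : 'M[F]_(m, p)) (z : 'M[F]_(m, n))
    (b : 'M[F]_(n, p)) :
  continuous (fun x : 'M[F]_(m, n) => c + (x - z) *m b).
Proof.
refine (@continuous_mxadd _ m p (fun=> c)
  (fun x : 'M[F]_(m, n) => (x - z) *m b) _ _).
  exact: cst_continuous.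
refine (@continuous_mulmx _ m n p (fun x : 'M[F]_(m, n) => x - z)
  (fun=> b) _ _).
  refine (@continuous_mxadd _ m n (@id 'M[F]_(m, n)) (fun=> - z) _ _).
    by move=> x; exact: cvg_id.
  exact: cst_continuous.
exact: cst_continuous.
Qed.

Hypothesis hF : hausdorff_space F.

Lemma open_unitmx n : open [set A : 'M[F]_n | A \in unitmx].
Proof.
have -> : [set A : 'M[F]_n | A \in unitmx] =
    (fun A => \det A) @^-1` [set~ 0].
  apply/seteqP; split=> A /=; rewrite unitmxE unitfE.
    by move/eqP.
  by move/eqP.
apply: (continuousP _).1; first exact: continuous_det.
rewrite openC; apply: accessible_closed_set1.
exact: hausdorff_accessible.
Qed.

Hypothesis ndF : ~ (forall A : set F, open A).

Lemma field_no_isolated (x : F) : ~ open [set x].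
Proof.
move=> ox; apply: ndF => A.
have -> : A = \bigcup_(a in A) ((fun y => y + (x - a)) @^-1` [set x]).
  apply/seteqP; split=> [a Aa|b [a Aa] /= ba].
    by exists a => //=; rewrite addrC subrK.
  suff -> : b = a by [].
  by apply: (addIr (x - a)); rewrite ba addrC subrK.
apply: bigcup_open => a _; apply: (continuousP _).1 ox.
by apply: continuous_fadd => y; [exact: cvg_id|exact: cvg_cst].
Qed.

(** The roots are split off one at a time: a nonempty open set is not reduced
    to a point, so it remains nonempty and open without the root found in it,
    and the quotient polynomial has a nonroot there. *)
Lemma dense_nonroots (p : {poly F}) : p != 0 -> dense [set x | ~~ root p x].
Proof.
elim: (size p) {-2}p (leqnn (size p)) => [|d IH] {}p.
  by rewrite leqn0 size_poly_eq0 => ->.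
move=> sp p0 O [x Ox] oO.
have [px|npx] := boolP (root p x); last by exists x.
have /factor_theorem[q pq] := px.
have q0 : q != 0 by apply: contraNneq p0 => q0; rewrite pq q0 mul0r.
have oOx : open (O `&` [set~ x]).
  apply: openI => //; rewrite openC; apply: accessible_closed_set1.
  exact: hausdorff_accessible.
have [] := IH q _ q0 _ _ oOx.
- by move: sp; rewrite pq size_Mmonic ?monicXsubC// size_XsubC addn2.
- apply: contrapT => /nonemptyPn Ox0; apply: (@field_no_isolated x).
  suff <- : O = [set x] by [].
  apply/seteqP; split=> [y Oy|_ ->//].
  by apply: contrapT => /= yx; have : (O `&` [set~ x]) y by []; rewrite Ox0.
- move=> y [[Oy yx] qy]; exists y; split => //=.
  by rewrite pq rootM negb_or qy root_XsubC /=; exact/eqP.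
Qed.

(** [A - t%:M] is invertible unless [t] is an eigenvalue of [A], and [t] can be
    taken close to 0 outside the roots of the characteristic polynomial. *)
Lemma dense_unitmx n : dense [set A : 'M[F]_n | A \in unitmx].
Proof.
move=> O [A OA] oO.
have cshift : continuous (fun t : F => A - t%:M : 'M[F]_n).
  apply: (@continuous_mxadd _ n n (fun=> A) (fun t => - t%:M)).
    exact: cst_continuous.
  apply: mx_continuous => i j; under eq_fun do rewrite !mxE.
  by case: (i == j) => /=; [exact: opp_continuous
    |exact: (@cst_continuous _ _ (- 0 : F))].
have [] := @dense_nonroots (char_poly A) (monic_neq0 (char_poly_monic A))
  ((fun t : F => A - t%:M) @^-1` O).
- by exists 0; rewrite /= raddf0 subr0.
- by apply: (continuousP _).1 oO.
- move=> t [Ot nt]; exists (A - t%:M); split=> //=.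
  move: nt; rewrite /= -eigenvalue_root_char /eigenvalue negbK.
  by rewrite kermx_eq0 row_free_unit.
Qed.

End TopologicalField.

(** * The open sets that stand for the colour classes *)

Lemma exists_mx_map (F : fieldType) n (v w : 'cV[F]_n) :
  w != 0 -> exists R : 'M[F]_n, R *m w = v.
Proof.
move=> /cV0Pn[i wi]; exists (v *m ((w i 0)^-1 *: delta_mx 0 i)).
rewrite -mulmxA -scalemxAl -rowE -[RHS]mulmx1; congr (v *m _).
by apply/matrixP => a b; rewrite !ord1 !mxE mulVf.
Qed.

Section LocalField.
Variables (F : topologicalFieldType) (n : nat).

Definition sum_regular (U : set 'M[F]_n) : Prop :=
  forall x y, U x -> U y -> \det (x + y) != 0.

(** For singular [z = x + y], the reflection [w |-> z - w] maps residual sets to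
    residual sets, and two matrices of [A] exchanged by it are adjacent; they
    are distinct because [w + w] is invertible when [w] is. *)
Lemma independent_sum_regular (A : set (GL F n)) (U : set 'M[F]_n) :
  (forall B : set 'M[F]_n, residual B -> dense B) -> 2%:R != 0 :> F ->
  independent (@regular_graph F n) A ->
  open U -> (\forall x \near @residual 'M[F]_n, (val @` A) x <-> U x) ->
  sum_regular U.
Proof.
move=> baire F2 indA oU AU x y Ux Uy; apply/eqP => xy0.
pose refl (w : 'M[F]_n) := x + y - w.
have crefl : continuous refl.
  refine (@continuous_mxadd F _ n n (fun=> x + y) (fun w : 'M[F]_n => - w) _ _).
    exact: cst_continuous.
  exact: continuous_mxopp.
have reflK : involutive refl by move=> w; rewrite /refl subKr.
have [||w [[Uw Urw] [AUw AUrw]]] :=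
    baire _ (filterI AU (residual_involution crefl reflK AU))
      (U `&` refl @^-1` U).
- by exists x; split=> //=; rewrite /refl addrC addKr.
- by apply: openI => //; apply: (continuousP refl).1.
have [a Aa aw] := AUw.2 Uw; have [b Ab bw] := AUrw.2 Urw.
have abxy : val a + val b = x + y by rewrite aw bw /refl addrC subrK.
apply: (indA a b Aa Ab); split; last by rewrite abxy.
move=> ab; move: xy0; rewrite -abxy -ab -mulr2n -scaler_nat detZ.
move=> /eqP; rewrite mulf_eq0 expf_eq0 (negPf F2) andbF /=.
by have := set_valP a; rewrite /GL /= unitmxE unitfE => /negPf ->.
Qed.

(** Suppose that all [g] in a nonempty open set have both [g *m a] and [g *m b]
    in the closure of [U].  An element [x] of [U] close to [g *m a] can be
    reached exactly on [v], in the sense that [g *m a *m v = x *m v], by a small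
    change of [g].  For this new [g], an element [y] of [U] close to [g *m b]
    takes on [v] a value close to [g *m b *m v = - (x *m v)], and a small change
    of [x] inside the open set [U] makes it exactly [- (x *m v)].  Then [x + y]
    is singular. *)
Lemma sum_regular_clique (U : set 'M[F]_n) (a b : 'M[F]_n) (v : 'cV[F]_n) :
  open U -> sum_regular U -> (a + b) *m v = 0 -> a *m v != 0 ->
  residual (~` [set g | closure U (g *m a) /\ closure U (g *m b)]).
Proof.
move=> oU regU abv av0.
have cmul (c : 'M[F]_n) : continuous (fun g : 'M[F]_n => g *m c).
  by apply: continuous_mulmx; [move=> x; exact: cvg_id|exact: cst_continuous].
apply: residual_open_dense.
  rewrite openC.
  have -> : [set g | closure U (g *m a) /\ closure U (g *m b)] =
    (fun g => g *m a) @^-1` closure U `&` (fun g => g *m b) @^-1` closure U.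
    by [].
  by apply: closedI; apply: closed_comp (@closed_closure _ U) => g _;
    exact: cmul.
move=> O [g0 Og0] oO; apply: contrapT => nOgood.
have Obad g : O g -> closure U (g *m a) /\ closure U (g *m b).
  by move=> Og; apply: contrapT => ng; apply: nOgood; exists g.
have v0 : v != 0 by apply: contraNneq av0 => ->; rewrite mulmx0.
have [R Rav] := exists_mx_map v av0; have [Q Qv] := exists_mx_map v v0.
have nbhs_affine (z0 z c : 'M[F]_n) (V : set 'M[F]_n) : open V -> V z0 ->
    nbhs z [set x | V (z0 + (x - z) *m c)].
  move=> oV Vz0; apply: (@continuous_mxaffine F n n n z0 z c z).
  by rewrite subrr mul0mx addr0; exact: open_nbhs_nbhs.
have [x [Ux Og]] : U `&` [set x | O (g0 + (x - g0 *m a) *m R)] !=set0.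
  by apply: (Obad g0 Og0).1; exact: nbhs_affine.
pose g := g0 + (x - g0 *m a) *m R; have {}Og : O g by [].
have gav : g *m a *m v = x *m v.
  rewrite -mulmxA /g mulmxDl -(mulmxA _ R) Rav mulmxBl mulmxA.
  by rewrite addrC subrK.
have gbv : g *m b *m v = - (x *m v).
  apply/eqP; rewrite -addr_eq0 -gav -mulmxDl -mulmxDr addrC -mulmxA abv.
  by rewrite mulmx0.
have [y [Uy Ux']] : U `&` [set y | U (x + (y - g *m b) *m - Q)] !=set0.
  by apply: (Obad g Og).2; exact: nbhs_affine.
pose z := x + (y - g *m b) *m - Q + y.
have zv : z *m v = 0.
  rewrite /z mulmxDl mulmxDl mulmxN mulNmx -(mulmxA _ Q) Qv mulmxBl gbv.
  by rewrite opprK opprD addrCA subrr addr0 addNr.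
have zU : z \in unitmx by rewrite unitmxE unitfE; exact: regU.
by move: v0; rewrite -(mulKmx zU v) zv mulmx0 eqxx.
Qed.

End LocalField.

(** * An infinite family of singular matrices with singular sums *)

Section SingularClique.
Variables (F : fieldType) (n : nat).

Definition clique_mx (j : nat) : 'M[F]_n.+2 :=
  \matrix_(r, c)
    (if (r == 0 :> nat) then
       if (c == 0 :> nat) then 1 else if (c == 1 :> nat) then j%:R else 0
     else 0).

(** A column killed by the sum of the [j]-th and the [k]-th matrices, whose
    first rows add up to [(2, j + k, 0, .., 0)]. *)
Definition clique_ker (j k : nat) : 'cV[F]_n.+2 :=
  \col_r (if (r == 0 :> nat) then (j + k)%:R
          else if (r == 1 :> nat) then - 2%:R else 0).

Lemma clique_mxE i j k :
  clique_mx i *m clique_ker j k = ((j + k)%:R - (i * 2)%:R) *: delta_mx 0 0.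
Proof.
apply/matrixP => r c; rewrite ord1 !mxE !big_ord_recl big1 => [|l _]; last first.
  by rewrite !mxE /= if_same mul0r.
rewrite !mxE /=; case: r => [[|r] ltr] /=.
  by rewrite !mul1r mulr1 addr0 mulrN natrM.
by rewrite !mul0r !addr0 mulr0.
Qed.

Lemma clique_mx_add j k : (clique_mx j + clique_mx k) *m clique_ker j k = 0.
Proof.
rewrite mulmxDl !clique_mxE -scalerDl addrACA -opprD -!natrD.
by rewrite -mulnDl addnn muln2 subrr scale0r.
Qed.

Lemma clique_mx_neq0 j k : [pchar F] =i pred0 -> j != k ->
  clique_mx j *m clique_ker j k != 0.
Proof.
move=> /pcharf0P F0 jk; rewrite clique_mxE scaler_eq0 negb_or; apply/andP; split.
  rewrite muln2 -addnn !natrD opprD addrACA subrr add0r subr_eq0.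
  apply: contra jk => /eqP kj; wlog : j k kj / (j <= k)%N => [wl|jk].
    have [/(wl _ _ kj)//|/ltnW/(wl _ _ (esym kj))] := leqP j k.
    by rewrite eq_sym.
  by rewrite eqn_leq jk -subn_eq0 -F0 natrB // kj subrr eqxx.
apply/negP => /eqP/matrixP/(_ 0 0)/eqP; rewrite !mxE !eqxx.
by rewrite oner_eq0.
Qed.

End SingularClique.

(** * The chromatic number *)

Lemma no_finite_borel_coloring (F : topologicalFieldType) (n : nat)
    (P : set (set (GL F n))) :
  local_field F -> [pchar F] =i pred0 -> (2 <= n)%N ->
  finite_set P -> ~ borel_coloring (@regular_graph F n) P.
Proof.
case: n P => [|[|n]] // P [hF ndF lcF] F0 _ finP [[covP _ _] borP indP].
have F2 : 2%:R != 0 :> F by rewrite ((pcharf0P F).1 F0).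
have baire (B : set 'M[F]_n.+2) : residual B -> dense B.
  apply: locally_compact_baire; first exact: mx_hausdorff.
  exact: mx_locally_compact.
have oGL : open (GL F n.+2) by exact: open_unitmx.
have /choice[U UP] : forall A : set (GL F n.+2), exists U : set 'M[F]_n.+2,
    P A -> open U /\
      \forall x \near @residual 'M[F]_n.+2, (val @` A) x <-> U x.
  move=> A; have [PA|nPA] := pselect (P A); last by exists set0.
  have [U oU AU] := borel_image_baire_property oGL (borP A PA).
  by exists U.
have regU A : P A -> sum_regular (U A).
  move=> PA; have [oU AU] := UP A PA.
  exact: (independent_sum_regular baire F2 (indP A PA) oU AU).
have covU : \bigcup_(A in P) closure (U A) = setT.
  apply/seteqP; split=> // x _.
  have : closed (\bigcup_(A in P) closure (U A)).
    by apply: closed_bigcup => // A _; exact: closed_closure.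
  apply=> B Bx.
  have resGL : residual (GL F n.+2).
    by apply: residual_open_dense => //; exact: dense_unitmx.
  have resU : residual (\bigcap_(A in P) [set x | (val @` A) x <-> U A x]).
    apply: residual_countable_bigcap; first exact: finite_set_countable.
    by move=> A PA; exact: (UP A PA).2.
  have [||y [By [Gy Uy]]] := baire _ (filterI resGL resU) B°.
  - by exists x.
  - exact: open_interior.
  pose y' : GL F n.+2 := SigSub (mem_set Gy).
  have [A PA Ay] : cover P id y' by rewrite covP.
  exists y; split; last exact: interior_subset.
  exists A => //; apply: subset_closure; apply/(Uy A PA).
  by exists y'.
pose m := @clique_mx F n.
have resg : residual (\bigcap_(A in P) \bigcap_j
    \bigcap_(k in [set k | j != k])
      ~` [set g | closure (U A) (g *m m j) /\ closure (U A) (g *m m k)]).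
  apply: residual_countable_bigcap; first exact: finite_set_countable.
  move=> A PA; apply: residual_bigcap => j.
  apply: residual_countable_bigcap => [|k jk]; first exact: (@countableP nat).
  exact: sum_regular_clique (UP A PA).1 (regU A PA)
    (clique_mx_add F n j k) (clique_mx_neq0 n F0 jk).
have [||g [_ gP]] := baire _ resg setT; [by exists 0|exact: openT|].
have /choice[f fP] : forall j, exists A, P A /\ closure (U A) (g *m m j).
  move=> j; have : setT (g *m m j) by [].
  by rewrite -covU => -[A PA clA]; exists A.
(* [f] colours the matrices [g *m m j]; it is injective, but has only finitely
   many values. *)
have fPT : f @^-1` P = setT by apply/seteqP; split=> // j _; exact: (fP j).1.
apply: infinite_nat; rewrite -fPT.
apply: finite_preimage finP => j k _ _ fjk; apply/eqP; apply: contraT => jk.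
have := gP (f j) (fP j).1 j I k jk; case; split; first exact: (fP j).2.
by rewrite fjk; exact: (fP k).2.
Qed.

Theorem theorem1p4 (F : topologicalFieldType) (hF : local_field F)
    (hchar : [pchar F] =i pred0) (n : nat) (hn : (2 <= n)%N) :
  (forall (T : Type) (C : set T),
      borel_chromatic_number (@regular_graph F n) C -> infinite_set C) /\
  ~ (exists P : set (set (GL F n)),
       finite_set P /\ borel_coloring (@regular_graph F n) P).
Proof.
split; last by move=> [P [finP]]; exact: no_finite_borel_coloring.
move=> T C [[P colP PC] _]; rewrite -(eq_finite_set PC) => finP.
exact: no_finite_borel_coloring colP.
Qed.
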